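(* Let $G$ be a Hausdorff ample groupoid and $R$ a commutative ring with $1$. The map $$I \longmapsto Y_I = \bigcup_{u\in G^{(0)}} I_u$$ defines a bijection from the set $\mathcal{L}(A_R(G))$ of two-sided ideals of the Steinberg algebra $A_R(G)$ to the set $\Delta_{G,R}$ of all open subsets $Y\subseteq X(G)$ satisfying the following three conditions: (D1) for all $u\in G^{(0)}$, $Y\cap RG_u^u$ is an ideal in $RG_u^u$; (D2) for all $u,v\in G^{(0)}$ and $t\in G_u^v$, the translation map $\tau_t$ restricts to an isomorphism $Y\cap RG_u^u\to Y\cap RG_v^v$; (D3) for all $\alpha\in Y$, there exists some $f\in A_R(G)$ such that $f_{p(\alpha)}=\alpha$ and $(f*\mathbf{1}_C)_v\in Y$ for all $v\in G^{(0)}$ and all $C\in \operatorname{Bis}_c(G)$.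
   Context: For a groupoid $G$ with unit space $G^{(0)}$, the source and range are $\boldsymbol{s}(x)=x^{-1}x$, $\boldsymbol{r}(x)=xx^{-1}$, and for units $u,v$ we put $G_u=\boldsymbol{s}^{-1}(u)$, $G^v=\boldsymbol{r}^{-1}(v)$, $G_u^v=G_u\cap G^v$; $G_u^u$ is the isotropy group at $u$. An ample groupoid is a topological groupoid in which $\boldsymbol{s}$ is a local homeomorphism and $G^{(0)}$ is locally compact, totally disconnected and Hausdorff. $\operatorname{Bis}_c(G)$ is the set of compact open bisections of $G$ (compact open subsets on which $\boldsymbol{s}$ and $\boldsymbol{r}$ are injective), and $\operatorname{Bis}_c(G^{(0)})$ is the set of compact open subsets of $G^{(0)}$. $\mathbf{1}_B$ is the $R$-valued characteristic function of $B$. $A_R(G)$ is the $R$-module of locally constant, compactly supported functions $f:G\to R$ with the convolution product $f*g(x)=\sum_{y\in G_{\boldsymbol{s}(x)}}f(xy^{-1})g(y)$. $RG_u^u$ is the group $R$-algebra of $G_u^u$, viewed as the set of finitely supported functions $G_u^u\to R$ with convolution. For $f\in A_R(G)$, $f_u=f|_{G_u^u}\in RG_u^u$. For an ideal $I$ of $A_R(G)$, $I_u=\{f_u\mid f\in I\}$. ''Ideal'' means two-sided ideal. $X(G)=\bigcup_{u\in G^{(0)}}RG_u^u$ (a disjoint union), and $p:X(G)\to G^{(0)}$ is given by $p(\alpha)=u$ if $\alpha\in RG_u^u$. For $f\in A_R(G)$, $s_f:G^{(0)}\to X(G)$ is $s_f(u)=f_u$. $X(G)$ has the topology with basis $\{s_f(U)\mid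 f\in A_R(G),\ U\in\operatorname{Bis}_c(G^{(0)})\}$. For $t\in G_u^v$, the translation isomorphism $\tau_t:RG_u^u\to RG_v^v$ is $\tau_t(\alpha)(z)=\alpha(t^{-1}zt)$ for $z\in G_v^v$. *)

(* Defs.v *)
From HB Require Import structures.
From mathcomp Require Import all_boot all_order all_algebra.
From mathcomp Require Import all_classical all_reals all_analysis.

Set Implicit Arguments.
Unset Strict Implicit.
Unset Printing Implicit Defensive.

Import GRing.Theory.

Local Open Scope classical_set_scope.
Local Open Scope ring_scope.

(* Renault's axioms; only the values of [gmul] at composable pairs are
   meaningful. *)
HB.mixin Record isGroupoid G := {
  composable : G -> G -> Prop;
  gmul : G -> G -> G;
  ginv : G -> G;
  ginvK : forall x, ginv (ginv x) = x;
  gmulA : forall x y z, composable x y -> composable y z ->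
    [/\ composable (gmul x y) z, composable x (gmul y z) &
        gmul (gmul x y) z = gmul x (gmul y z)];
  composableVx : forall x, composable (ginv x) x;
  gmulKx : forall x y, composable x y -> gmul (ginv x) (gmul x y) = y;
  gmulxK : forall x z, composable z x -> gmul (gmul z x) (ginv x) = z
}.

#[short(type="groupoidType")]
HB.structure Definition Groupoid := {G of isGroupoid G}.

HB.mixin Record Groupoid_isTopological G of Groupoid G & Topological G := {
  gmul_continuous :
    {within [set xy : G * G | composable xy.1 xy.2],
       continuous (fun xy : G * G => gmul xy.1 xy.2)};
  ginv_continuous : continuous (@ginv G)
}.

#[short(type="topologicalGroupoidType")]
HB.structure Definition TopologicalGroupoid :=
  {G of Groupoid_isTopological G & Groupoid G & Topological G}.

Arguments gmulA {s} [x y z].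
Arguments gmulKx {s} [x y].
Arguments gmulxK {s} [x z].

Declare Scope groupoid_scope.
Delimit Scope groupoid_scope with gpd.
Notation "x * y" := (gmul x y) : groupoid_scope.
Notation "x ^-1" := (ginv x) : groupoid_scope.

Definition units (G : groupoidType) : set G :=
  range (fun x : G => x^-1 * x)%gpd.

Arguments units G : clear implicits.

Notation unit_space G := (set_type (units G)).

Section GroupoidTheory.
Context {G : topologicalGroupoidType}.
Local Open Scope groupoid_scope.
Implicit Types x y z : G.

Fact src_subproof x : x^-1 * x \in units G.
Proof. by apply/mem_set; exists x. Qed.

Fact ran_subproof x : x * x^-1 \in units G.
Proof. by apply/mem_set; exists x^-1 => //=; rewrite ginvK. Qed.

Definition src x : unit_space G := exist _ (x^-1 * x) (src_subproof x).
Definition ran x : unit_space G := exist _ (x * x^-1) (ran_subproof x).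

Lemma unit_space_inj (u v : unit_space G) : sval u = sval v -> u = v.
Proof. exact: val_inj. Qed.

Lemma composablexV x : composable x x^-1.
Proof. by have := composableVx x^-1; rewrite ginvK. Qed.

Lemma src_inv x : src x^-1 = ran x.
Proof. by apply: unit_space_inj; rewrite /= ginvK. Qed.

Lemma ran_inv x : ran x^-1 = src x.
Proof. by apply: unit_space_inj; rewrite /= ginvK. Qed.

Lemma mul_ran x : x * x^-1 * x = x.
Proof. by have := gmulxK (composablexV x); rewrite ginvK. Qed.

Lemma mul_src x : x * (x^-1 * x) = x.
Proof.
by have [_ _ <-] := gmulA (composablexV x) (composableVx x); exact: mul_ran.
Qed.

Lemma composableP x y : composable x y <-> src x = ran y.
Proof.
split=> [xy|sr].
- apply: unit_space_inj => /=.
  have [_ xr _] := gmulA xy (composablexV y).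
  have := gmulKx xr.
  have [_ _ <-] := gmulA xy (composablexV y).
  by rewrite gmulxK.
- have /= e : sval (src x) = sval (ran y) by rewrite sr.
  have [_ xs _] := gmulA (composablexV x) (composableVx x).
  have [ry _ _] := gmulA (composablexV y) (composableVx y).
  rewrite -e in ry.
  have [+ _ _] := gmulA xs ry.
  by rewrite mul_src.
Qed.

Lemma src_mul x y : composable x y -> src (x * y) = src y.
Proof.
move=> xy; have [c _ _] := gmulA xy (composablexV y).
move/composableP: c => ->; exact: ran_inv.
Qed.

Lemma ran_mul x y : composable x y -> ran (x * y) = ran x.
Proof.
move=> xy; have [_ c _] := gmulA (composableVx x) xy.
by move/composableP: c => <-; exact: src_inv.
Qed.

(* [homset u v] is G_u^v; composition is in the functional order. *)
Definition homset (u v : unit_space G) : set G :=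
  [set x | src x = u /\ ran x = v].

Lemma homsetP u v (x : homset u v) : src (val x) = u /\ ran (val x) = v.
Proof. by case: x => x /= /set_mem. Qed.

Lemma homset_composable u v w (x : homset v w) (y : homset u v) :
  composable (val x) (val y).
Proof.
by apply/composableP; have [-> _] := homsetP x; have [_ ->] := homsetP y.
Qed.

Fact homset_mul_subproof u v w (x : homset v w) (y : homset u v) :
  val x * val y \in homset u w.
Proof.
have c := homset_composable x y; apply/mem_set; split.
- by rewrite (src_mul c); have [] := homsetP y.
- by rewrite (ran_mul c); have [] := homsetP x.
Qed.

Fact homset_inv_subproof u v (x : homset u v) : (val x)^-1 \in homset v u.
Proof.
by apply/mem_set; have [su rv] := homsetP x; split; rewrite ?src_inv ?ran_inv.
Qed.

Fact homset_id_subproof (u : unit_space G) : sval u \in homset u u.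
Proof.
have /set_mem [x _ xu] := valP u; apply/mem_set => /=.
have -> : u = src x by apply: unit_space_inj.
have c := composableVx x.
by split; rewrite /= ?(src_mul c) ?(ran_mul c) ?ran_inv.
Qed.

Definition homset_mul u v w (x : homset v w) (y : homset u v) : homset u w :=
  exist _ (val x * val y) (homset_mul_subproof x y).
Definition homset_inv u v (x : homset u v) : homset v u :=
  exist _ (val x)^-1 (homset_inv_subproof x).
Definition homset_id (u : unit_space G) : homset u u :=
  exist _ (sval u) (homset_id_subproof u).

Definition isotropy (u : unit_space G) : Type := set_type (homset u u).
HB.instance Definition _ u := Choice.copy (isotropy u) (set_type (homset u u)).

Section IsotropyGroup.
Variable u : unit_space G.

Let mulA : associative (@homset_mul u u u : isotropy u -> _ -> isotropy u).
Proof.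
move=> x y z; apply: val_inj => /=.
by have [_ _ ->] := gmulA (homset_composable x y) (homset_composable y z).
Qed.

Let mul1x : left_id (homset_id u : isotropy u) (@homset_mul u u u).
Proof.
move=> x; apply: val_inj => /=.
by have [_ /(congr1 sval) /= <-] := homsetP x; rewrite mul_ran.
Qed.

Let mulx1 : right_id (homset_id u : isotropy u) (@homset_mul u u u).
Proof.
move=> x; apply: val_inj => /=.
by have [/(congr1 sval) /= <- _] := homsetP x; rewrite mul_src.
Qed.

Let mulVx :
  left_inverse (homset_id u : isotropy u) (@homset_inv u u) (@homset_mul u u u).
Proof.
by move=> x; apply: val_inj => /=; have [/(congr1 sval) /= <- _] := homsetP x.
Qed.

Let mulxV :
  right_inverse (homset_id u : isotropy u) (@homset_inv u u)
    (@homset_mul u u u).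
Proof.
by move=> x; apply: val_inj => /=; have [_ /(congr1 sval) /= <-] := homsetP x.
Qed.

HB.instance Definition _ :=
  isGroup.Build (isotropy u) mulA mul1x mulx1 mulVx mulxV.

End IsotropyGroup.

End GroupoidTheory.

(* Taking [V = U] shows that [f @` U] is open. *)
Definition local_homeomorphism (X Y : topologicalType) (f : X -> Y) : Prop :=
  forall x, exists U : set X,
    [/\ open U, U x, set_inj U f, {within U, continuous f} &
        forall V, open V -> V `<=` U -> open (f @` V)].

Record ample (G : topologicalGroupoidType) : Prop := Ample {
  ample_src : local_homeomorphism (@src G);
  ample_locally_compact : locally_compact [set: unit_space G];
  ample_totally_disconnected : totally_disconnected [set: unit_space G];
  ample_hausdorff : hausdorff_space (unit_space G)
}.

Definition compact_open_set {X : topologicalType} : set (set X) :=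
  [set U | compact U /\ open U].

Definition compact_open_bisection {G : topologicalGroupoidType} :
    set (set G) :=
  [set B | [/\ compact_open_set B, set_inj B src & set_inj B ran]].

(* The ambient algebra A is a subset of V that need not contain a unit for
   [mul]. *)
Record two_sided_ideal (V : zmodType) (mul : V -> V -> V) (A I : set V) :
    Prop := TwoSidedIdeal {
  ideal_sub : I `<=` A;
  ideal0 : I 0;
  idealB : forall f g, I f -> I g -> I (f - g);
  idealMl : forall f g, A f -> I g -> I (mul f g);
  idealMr : forall f g, I f -> A g -> I (mul f g)
}.

Section GroupAlgebra.
Variables (R : comPzRingType) (H : groupType).

Definition group_algebra : set (H -> R) :=
  [set a | finite_set [set x | a x <> 0]].

Definition group_convolution (a b : H -> R) : H -> R :=
  fun x => \sum_(y \in [set: H]) a (x * y^-1)%g * b y.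

End GroupAlgebra.

Section SteinbergAlgebra.
Variables (R : comPzRingType) (G : topologicalGroupoidType).

Definition locally_constant (f : G -> R) : Prop :=
  forall x, \forall y \near x, f y = f x.

Definition steinberg : set (G -> R) :=
  [set f | locally_constant f /\ compact (closure [set x | f x <> 0])].

(* For f and g in [steinberg] the sum has finitely many nonzero terms. *)
Definition convolution (f g : G -> R) : G -> R :=
  fun x => \sum_(y \in [set y | src y = src x]) f (x * y^-1)%gpd * g y.

(* X(G) is the subset [bundle] of the disjoint union [prebundle] of the spaces
   of all functions on the isotropy groups; its projection p is [projT1]. *)
Definition prebundle : Type := {u : unit_space G & isotropy u -> R}.

Definition bundle : set prebundle :=
  [set a | group_algebra (projT2 a)].

Definition restr (f : G -> R) (u : unit_space G) : isotropy u -> R :=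
  fun x => f (sval x).
Arguments restr f u _ : clear implicits.

Definition bsection (f : G -> R) (u : unit_space G) : prebundle :=
  existT _ u (restr f u).

Definition bundle_basis : set (set prebundle) :=
  [set B | exists f U,
     [/\ steinberg f, compact_open_set U & B = bsection f @` U]].

Definition bundle_open (Y : set prebundle) : Prop :=
  exists2 F, F `<=` bundle_basis & Y = \bigcup_(B in F) B.

Definition fiber (Y : set prebundle) (u : unit_space G) :
    set (isotropy u -> R) :=
  [set a | Y (existT _ u a)].
Arguments fiber Y u _ : clear implicits.

Definition ideal_fiber (I : set (G -> R)) (u : unit_space G) :
    set (isotropy u -> R) :=
  [set restr f u | f in I].
Arguments ideal_fiber I u _ : clear implicits.

Definition ideal_bundle (I : set (G -> R)) : set prebundle :=
  \bigcup_(u in [set: unit_space G]) (existT _ u @` ideal_fiber I u).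

Definition translation (u v : unit_space G) (t : homset u v)
    (a : isotropy u -> R) : isotropy v -> R :=
  fun z => a (homset_mul (homset_inv t) (homset_mul z t)).

Definition algebra_iso (H K : groupType) (A : set (H -> R)) (B : set (K -> R))
    (phi : (H -> R) -> (K -> R)) : Prop :=
  [/\ set_bij A B phi,
      {in A &, {morph phi : a b / a + b}},
      {in A &, {morph phi : a b / group_convolution a b}} &
      forall c : R, {in A, {morph phi : a / c \*o a}}].

Definition steinberg_ideals : set (set (G -> R)) :=
  [set I | two_sided_ideal convolution steinberg I].

Record Delta_conditions (Y : set prebundle) : Prop := DeltaConditions {
  Delta1 : forall u : unit_space G,
    two_sided_ideal (@group_convolution R (isotropy u))
      (@group_algebra R (isotropy u)) (fiber Y u);
  Delta2 : forall (u v : unit_space G) (t : homset u v),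
    algebra_iso (fiber Y u) (fiber Y v) (translation t);
  Delta3 : forall a, Y a -> exists f : G -> R,
    [/\ steinberg f, bsection f (projT1 a) = a &
        forall v C, compact_open_bisection C ->
          Y (bsection (convolution f (\1_C)) v)]
}.

Definition Delta : set (set prebundle) :=
  [set Y | [/\ Y `<=` bundle, bundle_open Y & Delta_conditions Y]].

End SteinbergAlgebra.

Arguments steinberg_ideals R G : clear implicits.
Arguments Delta R G : clear implicits.

(* Main.v *)
(* An ideal I is recovered from its fibres I_u as follows. If f and g have the
   same restriction to the isotropy group at v, then the compact support of f -
   g is mapped by (src, ran) to a closed set missing (v, v), so 1_U * f * 1_U =
   1_U * g * 1_U for a small compact open neighbourhood U of v. Hence f_v \in
   I_v puts such a corner of f in I; translating by compact open bisections C
   and patching finitely many corners over the support of f, one finds that f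
   is in I if and only if (f * 1_C)_v is in I_v for all v and C. The inverse of
   I |-> Y_I thus has to send Y to the set of all f such that (f * 1_C)_v is in
   Y for all v and C. This set is a right ideal because the Steinberg algebra
   is spanned by the 1_C, and a left ideal because (1_B * h)_v = tau_b((h *
   1_B)_(src b)) when b is the arrow of the bisection B with range v; (D3) says
   precisely that its fibres exhaust Y. *)

Require Import Defs.
From mathcomp Require Import all_boot all_order all_algebra.
From mathcomp Require Import all_classical all_reals all_analysis.

Set Implicit Arguments.
Unset Strict Implicit.
Unset Printing Implicit Defensive.

Import GRing.Theory.

Local Open Scope classical_set_scope.
Local Open Scope ring_scope.

Arguments restr {R G} f u _.
Arguments fiber {R G} Y u _.
Arguments ideal_fiber {R G} I u _.

(** * Compact open bases *)

(** The sets outside of which the rest of [K] satisfies [P] form a filter, which is proper if [P K]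
    fails. A cluster point of it in [K] would then contradict the local hypothesis. The principle
    takes the place of finite subcovers in the compactness arguments below. *)
Lemma compact_induction (T : topologicalType) (K : set T) (P : set T -> Prop) :
    compact K -> P set0 -> (forall A B, A `<=` B -> P B -> P A) ->
    (forall A B, P A -> P B -> P (A `|` B)) ->
    (forall x, K x -> exists2 N, nbhs x N & P N) -> P K.
Proof.
move=> cK P0 PS PU Ploc; apply: contrapT => nPK.
pose F : set_system T := [set A | P (K `\` A)].
have FF : ProperFilter F.
  apply: Build_ProperFilter; first by rewrite /F /= setD0.
  split; first by rewrite /F /= setDT.
    by move=> A B FA FB; rewrite /F /= setDIr; exact: PU.
  by move=> A B AB; apply: PS => x [Kx nBx]; split=> // /AB.
have [|x [Kx clx]] := cK F FF; first by rewrite /F /= setDv.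
have [N Nx PN] := Ploc x Kx.
have [|y [] //] := clx (~` N) N _ Nx.
by apply: PS PN => y [_ /contrapT].
Qed.

(** Compact induction is run over [A] and, for each point [x] of [A], over [B], which reduces the
    claim to separating two points. At a union on one side, the open sets around that side are
    united and those around the other side are intersected. *)
Lemma compact_separated (T : topologicalType) (A B : set T) :
    hausdorff_space T -> compact A -> compact B -> A `&` B = set0 ->
  exists U V, [/\ open U, open V, A `<=` U, B `<=` V & U `&` V = set0].
Proof.
move=> hT cA cB AB0.
apply: (compact_induction (P := fun A => exists U V : set T,
    [/\ open U, open V, A `<=` U, B `<=` V & U `&` V = set0]) cA).
- exists set0, setT; split=> //; [exact: open0|exact: openT|exact: set0I].
- move=> C D CD [U [V [oU oV DU BV UV]]]; exists U, V.
  by split=> //; exact: subset_trans DU.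
- move=> C D [U [V [oU oV CU BV UV]]] [U' [V' [oU' oV' DU' BV' UV']]].
  exists (U `|` U'), (V `&` V'); split.
  + exact: openU.
  + exact: openI.
  + exact: setUSS.
  + by move=> x Bx; split; [exact: BV|exact: BV'].
  + rewrite -subset0 => x [[Ux|Ux] [Vx V'x]].
      by rewrite -UV.
    by rewrite -UV'.
- move=> x Ax.
  suff [U [V [oU oV Ux BV UV]]] : exists U V,
      [/\ open U, open V, U x, B `<=` V & U `&` V = set0].
    exists U; first exact: open_nbhs_nbhs.
    by exists U, V; split.
  apply: (compact_induction (P := fun B => exists U V : set T,
    [/\ open U, open V, U x, B `<=` V & U `&` V = set0]) cB).
  + exists setT, set0; split=> //; [exact: openT|exact: open0|exact: setI0].
  + move=> C D CD [U [V [oU oV DU BV UV]]]; exists U, V.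
    by split=> //; exact: subset_trans BV.
  + move=> C D [U [V [oU oV CU BV UV]]] [U' [V' [oU' oV' DU' BV' UV']]].
    exists (U `&` U'), (V `|` V'); split=> //.
    * exact: openI.
    * exact: openU.
    * exact: setUSS.
    * rewrite -subset0 => z [[Uz U'z] [Vz|V'z]].
        by rewrite -UV.
      by rewrite -UV'.
  + move=> y By.
    have xy : x != y.
      apply/eqP => xy; suff : set0 x by [].
      by rewrite -AB0; split=> //; rewrite xy.
    move: hT; rewrite open_hausdorff => /(_ x y xy) [[U V] /= []].
    rewrite !inE => Ux Vy [oU oV UV]; exists V; first exact: open_nbhs_nbhs.
    by exists U, V; split.
Qed.

Section CompactOpenBasis.
Variable T : topologicalType.
Hypotheses (lcT : locally_compact [set: T])
  (tdT : totally_disconnected [set: T]) (hT : hausdorff_space T).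

(* The intersection of the relatively clopen subsets of a compact neighbourhood
   of [x] which contain [x] is connected, hence equal to [[set x]]; by
   compactness, these sets form a neighbourhood basis at [x]. *)
Lemma compact_open_basis (x : T) (N : set T) :
  nbhs x N -> exists U, [/\ compact_open_set U, U x & U `<=` N].
Proof.
move=> Nx.
have [K Kx [cK clK]] : exists2 K, nbhs x K & compact K /\ closed K.
  have [K Kx cK] := @lcT x I; exists K => //.
  by move: Kx; rewrite within_interior // interiorT.
pose C (D : set T) :=
  [/\ closed D, D x, D `<=` K & exists2 V, open V & D = K `&` V].
pose Q := \bigcap_(D in C) D.
have CK : C K.
  split=> //; first exact: nbhs_singleton.
  by exists setT; [exact: openT|rewrite setIT].
have Qx : Q x by move=> D [].
have QK : Q `<=` K by move=> y; exact.
have clQ : closed Q by apply: closed_bigI => D [].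
have sepQ A : compact A -> A `&` Q = set0 -> exists2 D, C D & A `&` D = set0.
  move=> cA AQ0.
  apply: (compact_induction (P := fun A => exists2 D, C D & A `&` D = set0) cA).
  - by exists K => //; exact: set0I.
  - move=> A1 A2 A12 [D CD A2D]; exists D => //.
    by rewrite -subset0 -A2D; exact: setSI.
  - move=> A1 A2 [D [clD Dx DK [V oV DV]] A1D] [E [clE Ex EK [W oW EW]] A2E].
    exists (D `&` E); last first.
      by rewrite setIUl setIA A1D set0I set0U setICA A2E setI0.
    split=> //; first exact: closedI.
      by move=> y [/DK].
    by exists (V `&` W); [exact: openI|rewrite DV EW setIACA setIid].
  - move=> y Ay.
    have [D CD nDy] : exists2 D, C D & ~ D y.
      apply: contrapT => nD; have : (A `&` Q) y.
        by split=> // D CD; apply: contrapT => nDy; apply: nD; exists D.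
      by rewrite AQ0.
    exists (~` D); last by exists D => //; exact: setICl.
    by apply: open_nbhs_nbhs; split=> //; case: CD => /closed_openC.
(* One part of a separation of [Q] contains [x], and the other is shown to be empty. If [U] and [V]
   separate the two parts, some [D] in [C] lies in their union; then [D] cut down to [U] is again in
   [C], so [Q] lies in [U]. *)
have half B B' : closed B -> closed B' -> B `|` B' = Q -> B `&` B' = set0 ->
    B x -> B' = set0.
  move=> clB clB' BB' BB'0 Bx.
  have cp E : closed E -> E `<=` Q -> compact E.
    by move=> clE EQ; exact: (subclosed_compact clE cK (subset_trans EQ QK)).
  have BQ : B `<=` Q by rewrite -BB'; exact: subsetUl.
  have B'Q : B' `<=` Q by rewrite -BB'; exact: subsetUr.
  have [U [V [oU oV BU B'V UV0]]] :=
    compact_separated hT (cp _ clB BQ) (cp _ clB' B'Q) BB'0.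
  have [||D CD DUV] := sepQ (K `\` (U `|` V)).
  - by apply: compact_closedI => //; apply: open_closedC; exact: openU.
  - rewrite -subset0 => y [[_ nUV] Qy]; apply: nUV.
    by move: Qy; rewrite -BB' => -[/BU|/B'V]; [left|right].
  have [clD Dx DK [W oW DW]] := CD.
  (* The left side is relatively open in [K] and the right side is closed, so the set can belong to
     [C]. *)
  have DUE : D `&` U = D `&` ~` V.
    apply/seteqP; split=> y [Dy] => [Uy|nVy]; split=> //.
      by move=> Vy; have : (U `&` V) y by []; rewrite UV0.
    apply: contrapT => nUy.
    have : ((K `\` (U `|` V)) `&` D) y.
      by split=> //; split; [exact: DK|case].
    by rewrite DUV.
  have CDU : C (D `&` U).
    split=> [||y [/DK] //|].
    - by rewrite DUE; apply: closedI => //; exact: open_closedC.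
    - by split=> //; exact: BU.
    - by exists (W `&` U); [exact: openI|rewrite DW setIA].
  rewrite -subset0 => y B'y; have [_ Uy] := B'Q y B'y _ CDU.
  by rewrite -UV0; split=> //; exact: B'V.
have cQ : connected Q.
  move=> B B0 [W oW BW] [W' clW' BW'].
  have clB : closed B by rewrite BW'; exact: closedI.
  have clB' : closed (Q `\` B).
    by rewrite BW setDIr setDv set0U; apply: closedI => //; exact: open_closedC.
  have BQ : B `<=` Q by rewrite BW => y [].
  have [Bx|nBx] := pselect (B x).
    have /seteqP[QB _] : Q `\` B = set0.
      by apply: half Bx => //; [rewrite setDUK|rewrite setDIK].
    by apply/seteqP; split=> // y Qy; apply: contrapT => nBy; apply: (QB y).
  have B'x : (Q `\` B) x by [].
  case: B0 => z; rewrite (_ : B = set0) //.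
  apply: half B'x => //; first by rewrite setUC setDUK.
  by rewrite setIC setDIK.
have Q1 : Q `<=` [set x].
  by rewrite -(@tdT x I); exact: connected_component_max.
pose O := interior (K `&` N).
have Ox : O x by apply: nbhs_singleton; apply: nbhs_interior; exact: filterI.
have oO : open O by exact: open_interior.
have OKN : O `<=` K `&` N by exact: interior_subset.
have [||D [clD Dx DK [V oV DV]] OD0] := sepQ (K `\` O).
- by apply: compact_closedI => //; exact: open_closedC.
- by rewrite -subset0 => y [[_ nOy] /Q1 yx]; apply: nOy; rewrite yx.
have DO : D `<=` O.
  move=> y Dy; apply: contrapT => nOy.
  have : ((K `\` O) `&` D) y by split=> //; split=> //; exact: DK.
  by rewrite OD0.
exists D; split=> //; last by move=> y /DO/OKN[].
split; first exact: (subclosed_compact clD cK DK).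
(* [D] is only relatively open in [K], but it lies in the open subset [O] of [K], hence it is
   open. *)
rewrite (_ : D = O `&` V); first exact: openI.
apply/seteqP; split=> y; last by move=> [/OKN[Ky _] Vy]; rewrite DV.
by move=> Dy; split; [exact: DO|move: Dy; rewrite DV => -[]].
Qed.

End CompactOpenBasis.

(** * The topology of an ample groupoid *)

Section UnitSpace.
Context {G : topologicalGroupoidType}.
Implicit Types (x y z : G) (u v : unit_space G).

Lemma src_unit u : src (sval u) = u.
Proof. by have /set_mem[] := homset_id_subproof u. Qed.

Lemma ran_unit u : ran (sval u) = u.
Proof. by have /set_mem[] := homset_id_subproof u. Qed.

Lemma ginv_unit u : ((sval u)^-1)%gpd = sval u.
Proof.
have /= uVu := congr1 sval (src_unit u); have /= uuV := congr1 sval (ran_unit u).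
by rewrite -[LHS]mul_src ginvK uuV.
Qed.

Lemma ran_srcV : @ran G = src \o ginv.
Proof. by apply/funext => x /=; rewrite src_inv. Qed.

Lemma ginv_open (V : set G) : open V -> open (ginv @` V).
Proof.
move=> oV; rewrite (_ : _ @` V = ginv @^-1` V).
  by apply: open_comp => // x _; exact: ginv_continuous.
apply/seteqP; split=> [_ [x Vx <-]|x Vx]; first by rewrite /= ginvK.
by exists x^-1%gpd; rewrite ?ginvK.
Qed.

End UnitSpace.

Section AmpleGroupoid.
Context {G : topologicalGroupoidType} (ampleG : ample G).
Implicit Types (x y z : G) (u v : unit_space G).

Lemma src_continuous : continuous (@src G).
Proof.
move=> x; have [U [oU Ux _ /subspace_continuousP /(_ x Ux) + _]] :=
  ample_src ampleG x.
by rewrite within_interior // /interior; apply: open_nbhs_nbhs.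
Qed.

Lemma src_open (V : set G) : open V -> open (src @` V).
Proof.
move=> oV; rewrite openE => _ [x Vx <-].
have [U [oU Ux _ _ UV]] := ample_src ampleG x.
apply: (@filterS _ _ _ (src @` (U `&` V))).
  by move=> _ [y [_ Vy] <-]; exists y.
apply: open_nbhs_nbhs; split; last by exists x.
by apply: UV; [exact: openI|exact: subIsetl].
Qed.

Lemma ran_continuous : continuous (@ran G).
Proof.
rewrite ran_srcV => x; apply: continuous_comp; first exact: ginv_continuous.
exact: src_continuous.
Qed.

Lemma ran_open (V : set G) : open V -> open (ran @` V).
Proof. by move=> oV; rewrite ran_srcV -image_comp; exact/src_open/ginv_open. Qed.

Lemma sval_continuous : continuous (sval : unit_space G -> G).
Proof. exact: initial_continuous. Qed.

(* If [src] is injective on [U] and both [x] and [src x] lie in [U], then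
   [x = src x], because [src x] and [x] have the same source. *)
Lemma units_open : open (units G).
Proof.
rewrite openE => x xG; pose u : unit_space G := exist _ x (mem_set xG).
have /= sx := congr1 sval (src_unit u).
have [U [oU Ux injU _ _]] := ample_src ampleG x.
have ss : continuous (fun y => sval (src y) : G).
  move=> y; apply: continuous_comp; first exact: src_continuous.
  exact: sval_continuous.
apply: (@filterS _ _ _ (U `&` [set y | U (sval (src y))])).
  move=> y [Uy Usy]; have <- : sval (src y) = y.
    by apply: injU; rewrite ?inE ?src_unit.
  by exists y.
apply: open_nbhs_nbhs; split; last by split; rewrite //= sx.
by apply: openI => //; apply: (open_comp (f := fun y => sval (src y))).
Qed.

Lemma sval_open (V : set (unit_space G)) : open V -> open (sval @` V).
Proof.
move=> [W oW <-]; rewrite (_ : _ @` _ = W `&` units G).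
  by apply: openI => //; exact: units_open.
apply/seteqP; split=> [_ [u Wu <-]|x [Wx xG]].
  by split=> //; exact/set_mem/(valP u).
by exists (exist _ x (mem_set xG)).
Qed.

Lemma sval_compact_open (V : set (unit_space G)) :
  compact_open_set V -> compact_open_set (sval @` V).
Proof.
move=> [cV oV]; split; last exact: sval_open.
by apply: continuous_compact => //; apply: continuous_subspaceT sval_continuous.
Qed.

(** Sets of units may thus serve as the bisection [C] in (D3) and in the definition of
    [bundle_ideal]. *)
Lemma sval_bisection (V : set (unit_space G)) :
  compact_open_set V -> compact_open_bisection (sval @` V).
Proof.
move=> cV; split; first exact: sval_compact_open.
- by move=> _ _ /set_mem[u _ <-] /set_mem[v _ <-]; rewrite !src_unit => ->.
- by move=> _ _ /set_mem[u _ <-] /set_mem[v _ <-]; rewrite !ran_unit => ->.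
Qed.

Lemma unit_space_basis u (N : set (unit_space G)) :
  nbhs u N -> exists U, [/\ compact_open_set U, U u & U `<=` N].
Proof. by case: ampleG => _ ? ? ?; exact: compact_open_basis. Qed.

Lemma bisection_inv (B : set G) :
  compact_open_bisection B -> compact_open_bisection (ginv @` B).
Proof.
move=> [[cB oB] sB rB]; split; first split.
- by apply: continuous_compact => //; apply: continuous_subspaceT ginv_continuous.
- exact: ginv_open.
- move=> _ _ /set_mem[x Bx <-] /set_mem[y By <-].
  by rewrite !src_inv => /rB ->; rewrite ?inE.
- move=> _ _ /set_mem[x Bx <-] /set_mem[y By <-].
  by rewrite !ran_inv => /sB ->; rewrite ?inE.
Qed.

(* A local inverse of [src] is continuous, so it maps a compact open set to a
   compact open bisection. *)
Lemma bisection_basis x (N : set G) :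
  nbhs x N -> exists B, [/\ compact_open_bisection B, B x & B `<=` N].
Proof.
move=> Nx.
have [U [oU Ux injU _ _]] := ample_src ampleG x.
have [V [oV Vx injV _ _]] := ample_src ampleG x^-1%gpd.
(* [V] is a neighbourhood of [x^-1] on which [src] is injective, so [ran] is injective on its
   inverse. *)
pose W := U `&` (ginv @` V) `&` interior N.
have oW : open W.
  by apply: openI; [apply: openI => //; exact: ginv_open|exact: open_interior].
have Wx : W x.
  split; [split=> //|exact: nbhs_singleton (nbhs_interior Nx)].
  by exists x^-1%gpd; rewrite ?ginvK.
have injW y z : W y -> W z -> src y = src z -> y = z.
  by move=> [[Uy _] _] [[Uz _] _]; apply: injU; rewrite inE.
have [D [[cD oD] Dx DW]] : exists D,
    [/\ compact_open_set D, D (src x) & D `<=` src @` W].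
  apply: unit_space_basis; apply: open_nbhs_nbhs.
  by split; [exact: src_open|exists x].
pose B := W `&` (src @^-1` D).
(* The local inverse of [src]. The default [x] is taken only outside the image of [W], and this
   image contains [D]. *)
pose sec u := xget x [set w | W w /\ src w = u].
have secP w : W w -> sec (src w) = w.
  by move=> Ww; apply: xget_unique => // y [Wy yw]; exact: injW.
exists B; split=> //; last by move=> y [[_ Ny] _]; exact: interior_subset.
split; last 2 first.
- by move=> y z /set_mem[Wy _] /set_mem[Wz _]; exact: injW.
- move=> y z /set_mem[[[_ [y' Vy' <-]] _] _] /set_mem[[[_ [z' Vz' <-]] _] _].
  by rewrite !ran_inv => /injV ->; rewrite ?inE.
split; last first.
  by apply: openI => //; apply: open_comp => // y _; exact: src_continuous.
rewrite (_ : B = sec @` D); last first.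
  apply/seteqP; split=> [w [Ww Dw]|_ [u Du <-]].
    by exists (src w) => //; exact: secP.
  by have [w Ww wu] := DW _ Du; rewrite -wu secP //; split; rewrite //= wu.
apply: continuous_compact => //; apply/subspace_continuousP => u Du.
rewrite within_interior; last first.
  by rewrite /interior; apply: open_nbhs_nbhs.
have [w Ww wu] := DW _ Du; suff : sec @ u --> sec u by [].
rewrite -wu secP // => M Mw.
have : nbhs (src w) (src @` (W `&` interior M)).
  apply: open_nbhs_nbhs; split.
    by apply: src_open; apply: openI => //; exact: open_interior.
  by exists w => //; split=> //; exact: nbhs_singleton (nbhs_interior Mw).
apply: filterS => _ [y [Wy My] <-]; rewrite /= secP //; exact: interior_subset.
Qed.

End AmpleGroupoid.

(** * The Steinberg algebra *)

Section LocallyConstant.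
Context {R : comPzRingType} {G : topologicalGroupoidType}.
Implicit Types f g : G -> R.

Lemma locally_constant_preimage f (A : set R) :
  locally_constant f -> clopen (f @^-1` A).
Proof.
move=> lf; have op B : open (f @^-1` B).
  rewrite openE => x Bx; rewrite /interior; apply: filterS (lf x) => y fyx.
  by rewrite /preimage /= fyx.
by split; [exact: op|rewrite -[f @^-1` A]setCK; exact: open_closedC (op (~` A))].
Qed.

Lemma locally_constant_map2 (op : R -> R -> R) f g :
    locally_constant f -> locally_constant g ->
  locally_constant (fun x => op (f x) (g x)).
Proof.
move=> lf lg x; apply: filterS2 (lf x) (lg x) => y.
by move=> -> ->.
Qed.

Lemma locally_constant_cst (c : R) : locally_constant (fun=> c : R) (G := G).
Proof. by move=> x; exact: nearW. Qed.

Lemma locally_constant_indic (D : set G) :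
  clopen D -> locally_constant (\1_D : G -> R).
Proof.
move=> [oD cD] x; rewrite /indic; have [Dx|nDx] := pselect (D x).
- have : nbhs x D by exact: open_nbhs_nbhs.
  by apply: filterS => y Dy; rewrite !mem_set.
- have : nbhs x (~` D) by apply: open_nbhs_nbhs; split=> //; exact: closed_openC.
  by apply: filterS => y nDy; rewrite !memNset.
Qed.

Lemma steinbergP f :
  steinberg f <-> locally_constant f /\ compact [set x | f x <> 0].
Proof.
have E : locally_constant f -> closure [set x | f x <> 0] = [set x | f x <> 0].
  by move=> /(locally_constant_preimage (~` [set 0]))[_ /closure_id].
by rewrite /steinberg /=; split=> -[lf]; rewrite E.
Qed.

Lemma steinberg_supp f : steinberg f -> compact_open_set [set x | f x <> 0].
Proof.
move=> /steinbergP[lf cf]; split=> //.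
by have [] := locally_constant_preimage (~` [set 0]) lf.
Qed.

Lemma steinberg_sub (K : set G) g : compact K -> locally_constant g ->
  [set x | g x <> 0] `<=` K -> steinberg g.
Proof.
move=> cK lg gK; apply/steinbergP; split=> //.
have [_ clg] := locally_constant_preimage (~` [set 0]) lg.
exact: subclosed_compact gK.
Qed.

Lemma steinberg0 : steinberg (0 : G -> R).
Proof.
by apply: (steinberg_sub compact0) => [|x] //; exact: locally_constant_cst.
Qed.

Lemma steinbergB f g : steinberg f -> steinberg g -> steinberg (f - g).
Proof.
move=> /steinbergP[lf cf] /steinbergP[lg cg].
apply: (steinberg_sub (compactU cf cg)).
  exact: (locally_constant_map2 (fun a b => a - b) lf lg).
move=> x /= fg; apply: contrapT => /not_orP[/contrapT f0 /contrapT g0].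
by apply: fg; rewrite /GRing.add /= /GRing.opp /= f0 g0 subr0.
Qed.

Lemma steinbergD f g : steinberg f -> steinberg g -> steinberg (f + g).
Proof.
move=> sf sg; rewrite -[g]opprK -[- g]sub0r.
by apply: steinbergB => //; apply: steinbergB => //; exact: steinberg0.
Qed.

Lemma steinberg_mul f g :
  locally_constant f -> steinberg g -> steinberg (f \* g).
Proof.
move=> lf /steinbergP[lg cg]; apply: (steinberg_sub cg).
  exact: (locally_constant_map2 (fun a b => a * b) lf lg).
by move=> x /= fg g0; apply: fg; rewrite g0 mulr0.
Qed.

Lemma steinbergZ c f : steinberg f -> steinberg (c \*o f).
Proof. by apply: steinberg_mul; exact: locally_constant_cst. Qed.

End LocallyConstant.

(** * Indicators of compact open bisections span the algebra *)

Section Steinberg.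
Context {R : comPzRingType} {G : topologicalGroupoidType}.
Context (ampleG : ample G) (hausdorffG : hausdorff_space G).
Implicit Types (f g : G -> R) (B D : set G).

Lemma compact_open_clopen D : compact_open_set D -> clopen D.
Proof. by move=> [cD oD]; split=> //; exact: compact_closed. Qed.

Lemma steinberg_indic D : compact_open_set D -> steinberg (\1_D : G -> R).
Proof.
move=> cD; apply: (steinberg_sub cD.1).
  exact/locally_constant_indic/compact_open_clopen.
by move=> x /=; rewrite /indic; case: (boolP (x \in D)) => [/set_mem|].
Qed.

(** Every point of the support has a compact open bisection around it on which [f] is constant, and
    finitely many of these cover the support. Cutting [f] along them writes it as a sum of multiples
    of indicators of compact open bisections. *)
Lemma steinberg_ind (P : (G -> R) -> Prop) :
    P 0 -> (forall f g, P f -> P g -> P (f + g)) ->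
    (forall c B, compact_open_bisection B -> P (c \*o \1_B)) ->
  forall f, steinberg f -> P f.
Proof.
move=> P0 PD PB f sf; have [cK oK] := steinberg_supp sf.
set K := [set x | _] in cK oK.
(* Quantifying over all clopen [D] inside [U] makes the claim stable under unions of overlapping
   sets: [D] is split into its part in [U] and the remainder, which lies in [U']. *)
have [U [cU KU PU]] : exists U,
    [/\ clopen U, K `<=` U & forall D, clopen D -> D `<=` U -> P (\1_D \* f)].
  apply: (compact_induction cK (P := fun N => exists U, [/\ clopen U, N `<=` U
      & forall D, clopen D -> D `<=` U -> P (\1_D \* f)])).
  - exists set0; split=> [||D _ D0] //.
      by split; [exact: open0|exact: closed0].
    rewrite (_ : \1_D \* f = 0) //; apply/funext => x.
    by rewrite /= /indic memNset ?mul0r // => /D0.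
  - move=> A B AB [U [cU BU PU]]; exists U.
    by split=> //; exact: subset_trans BU.
  - move=> A B [U [cU AU PU]] [U' [cU' BU' PU']]; exists (U `|` U'); split.
    + exact: clopenU.
    + exact: setUSS.
    move=> D cD DUU'.
    rewrite (_ : _ \* f = (\1_(D `&` U) \* f) + (\1_(D `\` U) \* f)).
      apply: PD; first by apply: PU; [exact: clopenI|exact: subIsetr].
      apply: PU'; first by rewrite setDE; apply: clopenI => //; exact: clopenC.
      by move=> x [/DUU'[]].
    apply/funext => x; rewrite /GRing.add /= -mulrDl; congr (_ * _).
    rewrite /indic in_setI in_setD.
    by do 2 case: (x \in _); rewrite ?addr0 ?add0r.
  - move=> x Kx; have [lf _] := sf.
    have [B [bB Bx BN]] := bisection_basis ampleG (lf x).
    have [cB sB rB] := bB.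
    exists B; first by apply: open_nbhs_nbhs; split=> //; case: cB.
    exists B; split=> //; first exact: compact_open_clopen.
    move=> D [oD cD] DB; rewrite (_ : _ \* _ = f x \*o \1_D).
      apply: PB; split.
      * by split=> //; exact: subclosed_compact cD cB.1 DB.
      * by move=> y z /set_mem/DB yB /set_mem/DB zB; apply: sB; rewrite inE.
      * by move=> y z /set_mem/DB yB /set_mem/DB zB; apply: rB; rewrite inE.
    apply/funext => y /=; rewrite mulrC /indic.
    case: (boolP (y \in D)) => [/set_mem/DB/BN ->//|]; by rewrite !mulr0.
rewrite (_ : f = \1_K \* f).
  by apply: PU KU; split=> //; exact: compact_closed.
apply/funext => x /=; rewrite /indic.
case: (boolP (x \in K)) => [|/negP]; rewrite ?mul1r // inE /K /= mul0r.
by move/contrapT.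
Qed.

(** A bisection has at most one arrow with source [u], and finiteness passes to sums. This makes the
    sums in [convolution] finite for a Steinberg right factor. *)
Lemma steinberg_finite f (u : unit_space G) :
  steinberg f -> finite_set [set y | src y = u /\ f y <> 0].
Proof.
move: f; apply: steinberg_ind.
- by apply: (sub_finite_set _ (finite_set0 G)) => x [].
- move=> f g ff fg; apply: (@sub_finite_set _ _
    ([set y | src y = u /\ f y <> 0] `|` [set y | src y = u /\ g y <> 0])).
    move=> y [yu fgy]; have [f0|] := pselect (f y = 0); last by left.
    by right; split=> // g0; apply: fgy; rewrite /GRing.add /= f0 g0 addr0.
  by rewrite finite_setU.
- move=> c B [_ sB _].
  have [[x [xu xB]]|nx] := pselect (exists x, src x = u /\ B x).
    apply: (sub_finite_set _ (finite_set1 x)) => y [yu] /=; rewrite /indic.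
    case: (boolP (y \in B)) => [yB _|]; last by rewrite mulr0.
    by apply: sB; rewrite ?inE //; [exact: set_mem|rewrite yu].
  apply: (sub_finite_set _ (finite_set0 G)) => y [yu] /=; rewrite /indic.
  case: (boolP (y \in B)) => [/set_mem yB _|]; last by rewrite mulr0.
  by apply: nx; exists y.
Qed.

End Steinberg.

(** * Convolution *)

Section GroupoidAlgebra.
Context {G : topologicalGroupoidType}.
Implicit Types x y z : G.
Local Open Scope groupoid_scope.

Lemma gmulVK x y : src x = src y -> x * y^-1 * y = x.
Proof.
move=> xy; have /gmulxK : composable x y^-1.
  by apply/composableP; rewrite ran_inv.
by rewrite ginvK.
Qed.

Lemma gmulKV x y : ran x = ran y -> y * (y^-1 * x) = x.
Proof.
move=> xy; have /gmulKx : composable y^-1 x.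
  by apply/composableP; rewrite src_inv.
by rewrite ginvK.
Qed.

Lemma src_divr x y : src x = src y -> src (x * y^-1) = ran y.
Proof.
by move=> xy; rewrite src_mul ?src_inv //; apply/composableP; rewrite ran_inv.
Qed.

Lemma ran_divr x y : src x = src y -> ran (x * y^-1) = ran x.
Proof.
by move=> xy; rewrite ran_mul //; apply/composableP; rewrite ran_inv.
Qed.

Lemma src_divl x y : ran x = ran y -> src (x^-1 * y) = src y.
Proof.
by move=> xy; rewrite src_mul //; apply/composableP; rewrite src_inv.
Qed.

Lemma ran_divl x y : ran x = ran y -> ran (x^-1 * y) = src x.
Proof.
by move=> xy; rewrite ran_mul ?ran_inv //; apply/composableP; rewrite src_inv.
Qed.

Lemma gmul_assoc x y z :
  src x = ran y -> src y = ran z -> x * y * z = x * (y * z).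
Proof. by move=> /composableP xy /composableP yz; have [] := gmulA xy yz. Qed.

Lemma gmul_divr x y z : src x = src y -> src y = src z ->
  x * z^-1 * (y * z^-1)^-1 = x * y^-1.
Proof.
move=> xy yz; have -> : x * z^-1 = (x * y^-1) * (y * z^-1).
  rewrite -gmul_assoc ?gmulVK ?ran_inv //; first exact: src_divr.
by apply: gmulxK; apply/composableP; rewrite src_divr // ran_divr.
Qed.

Lemma gmul_divr_eq x y b : src x = src y -> x * y^-1 = b -> y = b^-1 * x.
Proof.
move=> xy <-; rewrite -{2}(gmulVK xy) gmulKx //.
by apply/composableP; exact: src_divr.
Qed.

Lemma gmul_divl_eq x b : ran x = ran b -> x * (b^-1 * x)^-1 = b.
Proof.
move=> xb; rewrite -{1}(gmulKV xb) gmulxK //.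
by apply/composableP; rewrite ran_divl.
Qed.

End GroupoidAlgebra.

Section Convolution.
Context {R : comPzRingType} {G : topologicalGroupoidType}.
Implicit Types (f g h : G -> R) (B C : set G) (x y b c : G) (T : set G).

(** The free choice of [T] allows several convolutions to be written over one common finite set, as
    the proofs of additivity require. *)
Lemma convolutionE T f g x : finite_set T -> T `<=` [set y | src y = src x] ->
    [set y | src y = src x /\ g y <> 0] `<=` T ->
  convolution f g x = \sum_(y \in T) f (x * y^-1)%gpd * g y.
Proof.
move=> fT TS ST; rewrite /convolution; apply/esym/fsbig_widen => // y [yx nTy] /=.
by rewrite (_ : g y = 0) ?mulr0 //; apply: contrapT => gy; exact/nTy/ST.
Qed.

(** No arrow of [C] other than [c] has source [src x], so a single summand survives: multiplying by
    the indicator of a bisection translates the argument. *)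
Lemma convolution_indicr f C x c : set_inj C src -> C c -> src c = src x ->
  convolution f \1_C x = f (x * c^-1)%gpd.
Proof.
move=> sC Cc cx; rewrite (convolutionE (T := [set c])) ?fsbig_set1.
- by rewrite /indic mem_set // mulr1.
- exact: finite_set1.
- by move=> y ->.
- move=> y [yx]; rewrite /indic; case: (boolP (y \in C)) => // yC _ /=.
  by apply: sC; rewrite ?inE //; [exact: set_mem|rewrite cx].
Qed.

Lemma convolution_indicr0 f C x : (forall c, C c -> src c <> src x) ->
  convolution f \1_C x = 0.
Proof.
move=> Cx; rewrite /convolution fsbig1 // => y yx.
by rewrite /indic memNset ?mulr0 // => /Cx.
Qed.

(** A nonzero summand needs [x * y^-1] in [B]; as this arrow has range [ran x], it is [b], and so
    [y] is [b^-1 * x]. *)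
Lemma convolution_indicl f B x b : set_inj B ran -> B b -> ran b = ran x ->
  convolution \1_B f x = f (b^-1 * x)%gpd.
Proof.
move=> rB Bb bx; rewrite /convolution -(fsbig_widen [set (b^-1 * x)%gpd]).
- by rewrite fsbig_set1 gmul_divl_eq // /indic mem_set // mul1r.
- by move=> _ ->; exact: src_divl.
- move=> y [yx yb] /=; rewrite /indic memNset ?mul0r // => By; apply: yb.
  by apply: gmul_divr_eq => //; apply: rB; rewrite ?inE // ran_divr.
Qed.

Lemma convolution_indicl0 f B x : (forall b, B b -> ran b <> ran x) ->
  convolution \1_B f x = 0.
Proof.
move=> Bx; rewrite /convolution fsbig1 // => y yx.
by rewrite /indic memNset ?mul0r // => /Bx; rewrite ran_divr.
Qed.

Lemma convolution0l f : convolution 0 f = 0 :> (G -> R).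
Proof.
by apply/funext => x; rewrite /convolution fsbig1 // => y _; rewrite mul0r.
Qed.

Lemma convolution0r f : convolution f 0 = 0 :> (G -> R).
Proof.
by apply/funext => x; rewrite /convolution fsbig1 // => y _; rewrite mulr0.
Qed.

(** If [c] is the arrow of [C] with source [src x], right translation by [c^-1] maps the arrows with
    source [src x] bijectively to those with source [ran c] and reindexes the sum. If there is no
    such [c], both sides vanish at [x]. *)
Lemma convolution_indicA f g C : set_inj C src ->
  convolution (convolution f g) \1_C = convolution f (convolution g \1_C).
Proof.
move=> sC; apply/funext => x.
have [[c [Cc cx]]|nc] := pselect (exists c, C c /\ src c = src x); last first.
  have nC y : src y = src x -> forall c, C c -> src c <> src y.
    by move=> -> c Cc cx; apply: nc; exists c.
  rewrite convolution_indicr0; last exact: nC.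
  by rewrite /convolution fsbig1 // => y /nC ny; rewrite fsbig1 ?mulr0 // => z zy;
    rewrite /indic memNset ?mulr0 // => /ny.
rewrite (convolution_indicr _ sC Cc cx) /convolution.
rewrite (reindex_fsbig (fun y => y * c^-1)%gpd [set y | src y = src x]).
  apply: eq_fsbigr => y /set_mem /= yx.
  have cy : src c = src y by rewrite cx yx.
  by rewrite gmul_divr // -(convolution_indicr g sC Cc cy).
split.
- by move=> y /= yx; rewrite !src_divr ?cx.
- move=> y z /set_mem /= yx /set_mem /= zx /(congr1 (fun w => w * c)%gpd).
  by rewrite !gmulVK ?cx.
- move=> z; rewrite /= src_divr ?cx // => zc.
  have zc' : composable z c by exact/composableP.
  by exists (z * c)%gpd; rewrite ?src_mul ?gmulxK.
Qed.

End Convolution.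

Section SteinbergConvolution.
Context {R : comPzRingType} {G : topologicalGroupoidType}.
Context (ampleG : ample G) (hausdorffG : hausdorff_space G).
Implicit Types (f g h : G -> R) (B C : set G) (x y b c : G) (T : set G).

Lemma convolutionDl f g h : steinberg h ->
  convolution (f + g) h = convolution f h + convolution g h.
Proof.
move=> sh; apply/funext => x.
have fT := steinberg_finite ampleG hausdorffG (src x) sh.
rewrite /GRing.add /= !(convolutionE _ fT); try by move=> y [].
rewrite -fsbig_split //; apply: eq_fsbigr => y _; exact: mulrDl.
Qed.

Lemma convolutionDr f g h : steinberg g -> steinberg h ->
  convolution f (g + h) = convolution f g + convolution f h.
Proof.
move=> sg sh; apply/funext => x.
have fT : finite_set ([set y | src y = src x /\ g y <> 0] `|`
                      [set y | src y = src x /\ h y <> 0]).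
  by rewrite finite_setU; split; exact: steinberg_finite.
rewrite /GRing.add /= !(convolutionE _ fT); try by move=> y; case=> -[].
- by rewrite -fsbig_split //; apply: eq_fsbigr => y _; exact: mulrDr.
- exact: subsetUr.
- exact: subsetUl.
- move=> y [yx gh]; have [g0|] := pselect (g y = 0); last by left.
  by right; split=> // h0; apply: gh; rewrite /= g0 h0 addr0.
Qed.

Lemma convolutionZl a f h : steinberg h ->
  convolution (a \*o f) h = a \*o convolution f h.
Proof.
move=> sh; apply/funext => x /=.
have fT := steinberg_finite ampleG hausdorffG (src x) sh.
rewrite !(convolutionE _ fT); try by move=> y [].
by rewrite fsbig_distrr //; apply: eq_fsbigr => y _; exact: esym (mulrA _ _ _).
Qed.

Lemma convolutionZr a f h : steinberg h ->
  convolution f (a \*o h) = a \*o convolution f h.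
Proof.
move=> sh; apply/funext => x /=.
have fT := steinberg_finite ampleG hausdorffG (src x) sh.
rewrite !(convolutionE _ fT) //; try by move=> y [].
  by rewrite fsbig_distrr //; apply: eq_fsbigr => y _; exact: mulrCA.
by move=> y [yx ay]; split=> // h0; apply: ay; rewrite /= h0 mulr0.
Qed.

End SteinbergConvolution.

(** * The Steinberg algebra is closed under convolution *)

Section ConvolutionSteinberg.
Context {R : comPzRingType} {G : topologicalGroupoidType}.
Context (ampleG : ample G) (hausdorffG : hausdorff_space G).
Implicit Types (f g h : G -> R) (B C : set G) (x y b c : G).

Lemma gmul_near x y (N : set G) : composable x y -> nbhs (x * y)%gpd N ->
  exists P Q, [/\ nbhs x P, nbhs y Q &
    forall p q, P p -> Q q -> composable p q -> N (p * q)%gpd].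
Proof.
move=> xy Nxy; have /subspace_continuousP /(_ (x, y) xy) := @gmul_continuous G.
move=> /(_ N Nxy) [[P Q] /= [Px Qy] PQ]; exists P, Q; split=> // p q Pp Qq.
by move=> pq; apply: (PQ (p, q)).
Qed.

(** This is the set where [src] of the first entry agrees with [ran] of the second, two continuous
    maps into the Hausdorff unit space. *)
Lemma closed_composable : closed [set xy : G * G | composable xy.1 xy.2].
Proof.
rewrite -[X in closed X]setCK; apply: open_closedC; rewrite openE => -[x y] nxy.
have neq : src x != ran y by apply/eqP => /composableP.
have := ample_hausdorff ampleG; rewrite open_hausdorff => /(_ _ _ neq).
move=> [[U V] /= []]; rewrite !inE => Ux Vy [oU oV UV0].
exists (src @^-1` U, ran @^-1` V).
  split; apply: open_nbhs_nbhs; split=> //; apply: open_comp => // z _.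
    exact: src_continuous.
  exact: ran_continuous.
move=> [p q] /= [Up Vq] /composableP pq.
have : (U `&` V) (src p) by split; rewrite // /preimage /= pq.
by rewrite UV0.
Qed.

Lemma compact_gmul (A B : set G) : compact A -> compact B ->
  compact [set (xy.1 * xy.2)%gpd |
           xy in A `*` B `&` [set xy : G * G | composable xy.1 xy.2]].
Proof.
move=> cA cB; apply: continuous_compact.
  apply: continuous_subspaceW (@gmul_continuous G).
  exact: subIsetr.
apply: compact_closedI; first exact: compact_setX.
exact: closed_composable.
Qed.

(** The support lies in the product of the support of [f] with [C], which is compact. For local
    constancy at [x], either [src x] is outside the closed set of sources of [C], or [C] has an
    arrow [c] there. In the second case, since [src] is open, arrows [y] near [x] meet arrows [c']
    of [C] near [c], and [y * c'^-1] stays where [f] is constant. *)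
Lemma steinberg_convolution_indic f C : steinberg f ->
  compact_open_bisection C -> steinberg (convolution f \1_C).
Proof.
move=> sf [[cC oC] sC rC]; have [lf _] := sf; have [cf _] := steinberg_supp sf.
apply: (steinberg_sub (compact_gmul cf cC)).
- move=> x.
  have [[c [Cc cx]]|nc] := pselect (exists c, C c /\ src c = src x); last first.
    have nCx : (~` (src @` C)) (src x) by move=> [c Cc cx]; apply: nc; exists c.
    have cl : closed (src @` C).
      apply: compact_closed; first exact: ample_hausdorff.
      apply: continuous_compact => //.
      exact/continuous_subspaceT/src_continuous.
    have : \forall y \near x, (~` (src @` C)) (src y).
      apply: (src_continuous ampleG (x := x)).
      by apply: open_nbhs_nbhs; split=> //; exact: closed_openC.
    apply: filterS => y nCy; rewrite !convolution_indicr0 // => c Cc cy.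
      by apply: nc; exists c.
    by apply: nCy; exists c.
  have xc : composable x c^-1%gpd by apply/composableP; rewrite ran_inv.
  have [P [Q [Px Qc PQ]]] := gmul_near xc (lf (x * c^-1)%gpd).
  have oW : open (src @` (C `&` interior (ginv @^-1` Q))).
    by apply: src_open => //; apply: openI => //; exact: open_interior.
  have Wx : (src @` (C `&` interior (ginv @^-1` Q))) (src x).
    exists c => //; split=> //; apply: nbhs_singleton; apply: nbhs_interior.
    exact: ginv_continuous.
  have : \forall y \near x, (src @` (C `&` interior (ginv @^-1` Q))) (src y).
    by apply: (src_continuous ampleG (x := x)); exact: open_nbhs_nbhs.
  apply: filterS2 Px => y Py [c' [Cc' Qc'] c'y].
  rewrite (convolution_indicr _ sC Cc cx) (convolution_indicr _ sC Cc' c'y).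
  apply: PQ => //; first exact: interior_subset Qc'.
  by apply/composableP; rewrite ran_inv.
- move=> x /= fCx.
  have [[c [Cc cx]]|nc] := pselect (exists c, C c /\ src c = src x).
    exists (x * c^-1, c)%gpd; last by rewrite /= gmulVK.
    split; last by apply/composableP; rewrite src_divr.
    by split=> //=; rewrite -(convolution_indicr f sC Cc cx).
  by case: fCx; apply: convolution_indicr0 => c Cc cx; apply: nc; exists c.
Qed.

Lemma steinberg_convolution f g :
  steinberg f -> steinberg g -> steinberg (convolution f g).
Proof.
move=> sf sg.
(* The induction principle does not record that its summands lie in the algebra, but additivity of
   [convolution] asks for this, so it is carried along. *)
suff [] : steinberg g /\ steinberg (convolution f g) by [].
move: g sg; apply: steinberg_ind => //.
- by split; rewrite ?convolution0r; exact: steinberg0.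
- move=> g h [sg sfg] [sh sfh]; split; first exact: steinbergD.
  by rewrite convolutionDr //; exact: steinbergD.
- move=> a B bB; have sB : steinberg (\1_B : G -> R).
    by case: bB => cB _ _; exact: steinberg_indic.
  split; first exact: steinbergZ.
  by rewrite convolutionZr //; apply/steinbergZ/steinberg_convolution_indic.
Qed.

Lemma steinberg_bisection B :
  compact_open_bisection B -> steinberg (\1_B : G -> R).
Proof. by case=> cB _ _; exact: steinberg_indic. Qed.

(** The only unit that can contribute at [x] is [ran x], and it acts trivially: indicators of sets
    of units act by truncation. *)
Lemma convolution_unit_indicl f (W : set (unit_space G)) :
  convolution \1_(sval @` W) f = \1_(ran @^-1` W) \* f.
Proof.
apply/funext => x /=; rewrite {2}/indic.
have [Wx|nWx] := pselect (W (ran x)).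
- rewrite mem_set // mul1r (@convolution_indicl _ _ _ _ _ (sval (ran x))).
  + by rewrite ginv_unit mul_ran.
  + by move=> _ _ /set_mem[u _ <-] /set_mem[v _ <-]; rewrite !ran_unit => ->.
  + by exists (ran x).
  + exact: ran_unit.
- rewrite memNset // mul0r convolution_indicl0 // => _ [u Wu <-].
  by rewrite ran_unit => ux; apply: nWx; rewrite -ux.
Qed.

Lemma convolution_unit_indicr f (W : set (unit_space G)) :
  convolution f \1_(sval @` W) = \1_(src @^-1` W) \* f.
Proof.
apply/funext => x /=; rewrite {2}/indic.
have [Wx|nWx] := pselect (W (src x)).
- rewrite mem_set // mul1r (@convolution_indicr _ _ _ _ _ (sval (src x))).
  + by rewrite ginv_unit mul_src.
  + by move=> _ _ /set_mem[u _ <-] /set_mem[v _ <-]; rewrite !src_unit => ->.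
  + by exists (src x).
  + exact: src_unit.
- rewrite memNset // mul0r convolution_indicr0 // => _ [u Wu <-].
  by rewrite src_unit => ux; apply: nWx; rewrite -ux.
Qed.

End ConvolutionSteinberg.

(** * Isotropy groups and translations *)

Section Isotropy.
Context {R : comPzRingType} {G : topologicalGroupoidType}.
Context (ampleG : ample G) (hausdorffG : hausdorff_space G).
Implicit Types (f g h : G -> R) (B C : set G) (x y b c : G) (u v : unit_space G).

Lemma restr_group_algebra f u : steinberg f -> group_algebra (restr f u).
Proof.
move=> sf; apply: (@sub_finite_set _ _
    ((sval : isotropy u -> G) @^-1` [set y | src y = u /\ f y <> 0])).
  by move=> x /= fx; have [] := homsetP x.
apply: finite_preimage; first by move=> x y _ _; exact: val_inj.
exact: steinberg_finite.
Qed.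

(** Restriction to an isotropy group is not multiplicative in general, because arrows from [u] to
    other units also contribute to [convolution]. The hypothesis says that these terms vanish. *)
Lemma restr_convolution f g u :
    (forall x y, homset u u x -> src y = u -> ~ homset u u y ->
       f (x * y^-1)%gpd * g y = 0) ->
  restr (convolution f g) u =
  group_convolution (restr f u) (restr g u).
Proof.
move=> fg0; apply/funext => x; have [sx rx] := homsetP x.
rewrite /restr /convolution /group_convolution sx.
rewrite -(fsbig_widen (homset u u)).
- apply: (reindex_fsbig (sval : isotropy u -> G)); split=> //.
  + by move=> y _; exact: homsetP.
  + by move=> y z _ _; exact: val_inj.
  + by move=> y uy; exists (exist _ y (mem_set uy)).
- by move=> y [].
- by move=> y [yu ny]; apply: fg0 => //; exact: homsetP.
Qed.

(* Restriction to [u] is multiplicative on products with this extension, because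
   it vanishes on the arrows which start or end at [u] but not both. *)
Lemma steinberg_extension u (a : isotropy u -> R) : group_algebra a ->
  exists f, [/\ steinberg f, restr f u = a &
    forall y, src y = u \/ ran y = u -> f y <> 0 -> homset u u y].
Proof.
move=> /finite_seqP[s sE].
suff [f [sf fE fu]] : exists f, [/\ steinberg f,
    forall x : isotropy u, f (sval x) = if x \in s then a x else 0 &
    forall y, src y = u \/ ran y = u -> f y <> 0 -> homset u u y].
  exists f; split=> //; apply/funext => x; rewrite /restr fE.
  case: ifPn => // /negP xs; apply/esym; apply: contrapT => ax.
  by apply: xs; rewrite -[is_true _]/([set` s] x) -sE.
elim: s {sE} => [|z s [f [sf fE fu]]].
  by exists 0; split=> //; exact: steinberg0.
(* A repeated entry of the list must not add its value a second time. *)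
have [zs|zs] := boolP (z \in s).
  exists f; split=> // x; rewrite fE inE; case: eqP => [->|//].
  by rewrite zs.
have [B [bB Bz _]] := bisection_basis ampleG (@filterT _ (nbhs (sval z)) _).
have [_ sB rB] := bB; have [sz rz] := homsetP z.
(* Among the arrows that start or end at [u], the bisection [B] contains only [z], so adding a
   multiple of its indicator changes no other value there. *)
have Bu y : src y = u \/ ran y = u -> B y -> y = sval z.
  by move=> [yu|yu] By; [apply: sB|apply: rB]; rewrite ?inE ?yu.
exists (f + a z \*o \1_B); split.
- apply: steinbergD => //; apply: steinbergZ.
  exact: steinberg_bisection bB.
- move=> x; have [sx rx] := homsetP x.
  rewrite /GRing.add /= fE inE /indic; case: (eqVneq x z) => [->|xz] /=.
    by rewrite (negbTE zs) add0r mem_set // mulr1.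
  rewrite memNset ?mulr0 ?addr0 // => Bx; move/eqP: xz; apply.
  by apply: val_inj; apply: Bu => //; left.
- move=> y yu; rewrite /GRing.add /= /indic.
  have [By _|nBy] := pselect (B y); first by rewrite (Bu y).
  by rewrite memNset // mulr0 addr0; exact: fu.
Qed.

End Isotropy.

Section HomsetAlgebra.
Context {G : topologicalGroupoidType}.
Implicit Types u v w r : unit_space G.

Lemma homset_mulA u v w r (x : homset w r) (y : homset v w) (z : homset u v) :
  homset_mul x (homset_mul y z) = homset_mul (homset_mul x y) z.
Proof.
apply: val_inj => /=.
by have [_ _ ->] := gmulA (homset_composable x y) (homset_composable y z).
Qed.

Lemma homset_mul1x u v (x : homset u v) : homset_mul (homset_id v) x = x.
Proof.
apply: val_inj => /=; have [_ /(congr1 sval) /= <-] := homsetP x.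
exact: mul_ran.
Qed.

Lemma homset_mulx1 u v (x : homset u v) : homset_mul x (homset_id u) = x.
Proof.
apply: val_inj => /=; have [/(congr1 sval) /= <- _] := homsetP x.
exact: mul_src.
Qed.

Lemma homset_mulxV u v (x : homset u v) :
  homset_mul x (homset_inv x) = homset_id v.
Proof. by apply: val_inj; have [_ /(congr1 sval) /= <-] := homsetP x. Qed.

Lemma homset_invK u v (t : homset u v) : homset_inv (homset_inv t) = t.
Proof. by apply: val_inj; rewrite /= ginvK. Qed.

Definition conj_homset u v (t : homset u v) (z : isotropy v) : isotropy u :=
  homset_mul (homset_inv t) (homset_mul z t).

Lemma conj_homsetK u v (t : homset u v) :
  cancel (conj_homset t) (conj_homset (homset_inv t)).
Proof.
move=> z; rewrite /conj_homset homset_invK !homset_mulA homset_mulxV.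
by rewrite homset_mul1x -homset_mulA homset_mulxV homset_mulx1.
Qed.

Lemma conj_homsetM u v (t : homset u v) (x y : isotropy v) :
  conj_homset t (x * y)%g = (conj_homset t x * conj_homset t y)%g.
Proof.
rewrite /conj_homset; rewrite -[(x * y)%g]/(homset_mul x y).
rewrite -[RHS]/(homset_mul _ _) -!homset_mulA; do 2 congr homset_mul.
by rewrite [RHS]homset_mulA homset_mulxV homset_mul1x.
Qed.

Lemma conj_homset_bij u v (t : homset u v) :
  set_bij [set: isotropy v] [set: isotropy u] (conj_homset t).
Proof.
split=> // [x y _ _|z _]; first exact: (can_inj (conj_homsetK t)).
exists (conj_homset (homset_inv t) z) => //.
by rewrite -{1}(homset_invK t) conj_homsetK.
Qed.

End HomsetAlgebra.

Section Translation.
Context {R : comPzRingType} {G : topologicalGroupoidType}.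
Implicit Types u v : unit_space G.

Lemma translationE u v (t : homset u v) (a : isotropy u -> R) :
  translation t a = a \o conj_homset t.
Proof. by []. Qed.

Lemma translationK u v (t : homset u v) :
  cancel (@translation R G u v t) (translation (homset_inv t)).
Proof.
move=> a; rewrite !translationE; apply/funext => z /=.
by rewrite -{1}(homset_invK t) conj_homsetK.
Qed.

Lemma translation_convolution u v (t : homset u v) (a b : isotropy u -> R) :
  translation t (group_convolution a b) =
  group_convolution (translation t a) (translation t b).
Proof.
apply/funext => z; rewrite translationE /group_convolution /=.
rewrite (reindex_fsbig (conj_homset t) setT) //; last exact: conj_homset_bij.
apply: eq_fsbigr => w _; rewrite !translationE /=; congr (a _ * _).
by rewrite -[in LHS](mulgVK w z) conj_homsetM mulgK.
Qed.

Lemma translation_algebra_iso u v (t : homset u v)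
    (A : set (isotropy u -> R)) (B : set (isotropy v -> R)) :
    {homo translation t : a / A a >-> B a} ->
    {homo translation (homset_inv t) : a / B a >-> A a} ->
  algebra_iso A B (translation t).
Proof.
move=> AB BA; split=> //.
- split=> // [a b _ _|b Bb]; first exact: (can_inj (translationK t)).
  exists (translation (homset_inv t) b); first exact: BA.
  by rewrite -{1}(homset_invK t) translationK.
- by move=> a b _ _; exact: translation_convolution.
Qed.

(** At [z], the left factor replaces the argument by [t^-1 * z] and the right factor then multiplies
    it by [t]. Translation by [t] is thus realized by two-sided multiplication inside the
    algebra. *)
Lemma restr_conj_indic f B u v (t : homset u v) :
    set_inj B src -> set_inj B ran -> B (sval t) ->
  restr (convolution \1_B (convolution f \1_(ginv @` B))) v =
  translation t (restr (f : G -> R) u).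
Proof.
move=> sB rB Bt; have [st rt] := homsetP t.
apply/funext => z; have [sz rz] := homsetP z.
rewrite /restr (convolution_indicl _ rB Bt); last by rewrite rz.
rewrite (@convolution_indicr _ _ _ _ _ (sval t)^-1%gpd).
- rewrite ginvK /= gmul_assoc ?src_inv ?rt ?rz ?sz //.
- move=> _ _ /set_mem[x Bx <-] /set_mem[y By <-].
  by rewrite !src_inv => /rB ->; rewrite ?inE.
- by exists (sval t).
- by rewrite src_inv src_divl ?rt ?rz ?sz.
Qed.

(** Both sides evaluate [h] at [t^-1 * z]. The identity trades a left multiplication for a right
    one, which is the kind that (D3) controls. *)
Lemma restr_indicl h B u v (t : homset u v) :
    set_inj B src -> set_inj B ran -> B (sval t) ->
  restr (convolution \1_B h) v =
  translation t (restr (convolution (h : G -> R) \1_B) u).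
Proof.
move=> sB rB Bt; have [st rt] := homsetP t.
apply/funext => z; have [sz rz] := homsetP z.
rewrite /restr (convolution_indicl _ rB Bt); last by rewrite rz.
rewrite translationE /= (convolution_indicr _ sB Bt).
  have /(congr1 sval) /= <- // : homset_mul (conj_homset t z) (homset_inv t) =
      homset_mul (homset_inv t) z.
  by rewrite /conj_homset -!homset_mulA homset_mulxV homset_mulx1.
by rewrite st; have [] := homsetP (conj_homset t z).
Qed.

End Translation.

(** * Localization of ideals *)

Section IdealLocalization.
Context {R : comPzRingType} {G : topologicalGroupoidType}.
Context (ampleG : ample G) (hausdorffG : hausdorff_space G).
Implicit Types (f g h : G -> R) (B C : set G) (u v : unit_space G).
Implicit Types I J : set (G -> R).

Lemma two_sided_idealD (V : zmodType) (mul : V -> V -> V) (A I : set V) a b :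
  two_sided_ideal mul A I -> I a -> I b -> I (a + b).
Proof.
move=> idI Ia Ib; rewrite -[b]opprK -[- b]sub0r.
by apply: (idealB idI) => //; apply: (idealB idI) => //; exact: ideal0 idI.
Qed.

Lemma steinberg_unit_indic (W : set (unit_space G)) :
  compact_open_set W -> steinberg (\1_(sval @` W) : G -> R).
Proof. by move=> cW; apply: steinberg_indic => //; exact: sval_compact_open. Qed.

Lemma convolution_unit_indic f (W V : set (unit_space G)) :
  convolution (convolution \1_(sval @` W) f) \1_(sval @` V) =
  \1_(ran @^-1` W `&` src @^-1` V) \* f.
Proof.
rewrite convolution_unit_indicl convolution_unit_indicr; apply/funext => x /=.
rewrite mulrA /indic in_setI; congr (_ * _).
by do 2 case: (x \in _); rewrite ?mulr1 ?mulr0.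
Qed.

Lemma ideal_corner I f (W V : set (unit_space G)) :
    two_sided_ideal (@convolution R G) (@steinberg R G) I -> compact_open_set W ->
    compact_open_set V -> I f ->
  I (\1_(ran @^-1` W `&` src @^-1` V) \* f).
Proof.
move=> idI cW cV If; rewrite -convolution_unit_indic.
apply: (Defs.idealMr idI); last exact: steinberg_unit_indic.
by apply: (Defs.idealMl idI) => //; exact: steinberg_unit_indic.
Qed.

(** Finitely many of the given corners cover the support of [f]. A union of corners need not be a
    corner, so the compact induction works with general sets [M] and carries along that truncation
    to [M] preserves [I]; this is what patching two pieces uses. *)
Lemma ideal_local I f :
    two_sided_ideal (@convolution R G) (@steinberg R G) I -> steinberg f ->
    (forall x, exists W V : set (unit_space G),
       [/\ compact_open_set W, compact_open_set V, W (ran x), V (src x) &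
           I (\1_(ran @^-1` W `&` src @^-1` V) \* f)]) ->
  I f.
Proof.
move=> idI sf locf; have [cK _] := steinberg_supp sf.
have [M [KM _ IMf]] : exists M : set G, [/\ [set x | f x <> 0] `<=` M,
    forall g, I g -> I (\1_M \* g) & I (\1_M \* f)].
  apply: (compact_induction (P := fun N => exists M : set G, [/\ N `<=` M,
    forall g, I g -> I (\1_M \* g) & I (\1_M \* f)]) cK).
  - have E g : \1_set0 \* g = 0 :> (G -> R).
      by apply/funext => x; rewrite /= indic0 mul0r.
    by exists set0; rewrite E; split=> // [g _|]; rewrite ?E; exact: ideal0 idI.
  - move=> N N' NN' [M [N'M MI Mf]]; exists M.
    by split=> //; exact: subset_trans N'M.
  - move=> N N' [M [NM MI Mf]] [M' [N'M' M'I M'f]]; exists (M `|` M').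
    (* Inclusion-exclusion, arranged so that each term is obtained by truncating to [M] and [M'] in
       turn. *)
    have E g : \1_(M `|` M') \* g =
        \1_M \* g + (\1_M' \* g - \1_M' \* (\1_M \* g)).
      apply/funext => x; rewrite /GRing.add /= /GRing.opp /= /indic in_setU.
      by do 2 case: (x \in _);
        rewrite /= ?(mulr1n, mulr0n, mul1r, mul0r, mulr0);
        rewrite ?(subrr, subr0, addr0, add0r).
    split=> [|g Ig|]; first exact: setUSS.
      rewrite E; apply: (two_sided_idealD idI); first exact: MI.
      by apply: (idealB idI); [exact: M'I|exact/M'I/MI].
    rewrite E; apply: (two_sided_idealD idI) => //.
    by apply: (idealB idI) => //; exact: M'I.
  - move=> x _; have [W [V [cW cV Wx Vx If]]] := locf x.
    exists (ran @^-1` W `&` src @^-1` V).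
      apply: filterI.
        apply: (ran_continuous ampleG (x := x)).
        by apply: open_nbhs_nbhs; split=> //; case: cW.
      apply: (src_continuous ampleG (x := x)).
      by apply: open_nbhs_nbhs; split=> //; case: cV.
    exists (ran @^-1` W `&` src @^-1` V); split=> // g Ig.
    exact: ideal_corner.
rewrite (_ : f = \1_M \* f) //; apply/funext => x /=; rewrite /indic.
have [f0|/KM Mx] := pselect (f x = 0); first by rewrite f0 mulr0.
by rewrite mem_set // mul1r.
Qed.

(* [f - g] vanishes on the isotropy group at [v], so (src, ran) maps its compact
   support to a compact set which does not contain [(v, v)]. *)
Lemma restr_eq_local f g v : steinberg f -> steinberg g ->
    restr f v = restr g v ->
  exists U : set (unit_space G), [/\ compact_open_set U, U v &
    \1_(ran @^-1` U `&` src @^-1` U) \* f = \1_(ran @^-1` U `&` src @^-1` U) \* g].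
Proof.
move=> sf sg fgv; have [cK _] := steinberg_supp (steinbergB sf sg).
have sep u : u <> v -> exists A B : set (unit_space G),
    [/\ open A, A u, nbhs v B & A `&` B = set0].
  move=> /eqP uv; have := ample_hausdorff ampleG; rewrite open_hausdorff.
  move=> /(_ _ _ uv) [[A B] /= []]; rewrite !inE => Au Bv [oA oB AB0].
  by exists A, B; split=> //; exact: open_nbhs_nbhs.
have [N [Nv NK]] : exists N : set (unit_space G), nbhs v N /\
    forall y, (f - g) y <> 0 -> ~ (N (ran y) /\ N (src y)).
  apply: (compact_induction (P := fun K => exists N : set (unit_space G),
    nbhs v N /\ forall y, K y -> ~ (N (ran y) /\ N (src y))) cK).
  - by exists setT; split=> //; exact: filterT.
  - by move=> A B AB [N [Nv NB]]; exists N; split=> // y /AB; exact: NB.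
  - move=> A B [N [Nv NA]] [M [Mv MB]]; exists (N `&` M).
    split; first exact: filterI.
    by move=> y [/NA|/MB] NM [[? ?] [? ?]]; exact: NM.
  - move=> x fgx; have [xv|xv] := pselect (src x = v /\ ran x = v).
      exfalso; apply: fgx; rewrite /GRing.add /= /GRing.opp /=.
      have := congr1 (fun a => a (exist _ x (mem_set xv))) fgv.
      by rewrite /restr /= => ->; rewrite subrr.
    have [sx|sx] := pselect (src x = v); last first.
      have [A [B [oA Ax Bv AB0]]] := sep _ sx; exists (src @^-1` A).
        by apply: (src_continuous ampleG (x := x)); exact: open_nbhs_nbhs.
      exists B; split=> // y Ay [_ By].
      by have : (A `&` B) (src y) by []; rewrite AB0.
    have rx : ran x <> v by move=> rx; apply: xv.
    have [A [B [oA Ax Bv AB0]]] := sep _ rx; exists (ran @^-1` A).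
      by apply: (ran_continuous ampleG (x := x)); exact: open_nbhs_nbhs.
    exists B; split=> // y Ay [By _].
    by have : (A `&` B) (ran y) by []; rewrite AB0.
have [U [cU Uv UN]] := unit_space_basis ampleG Nv.
exists U; split=> //; apply/funext => y; rewrite /= /indic.
have [[Ury Usy]|nU] := pselect ((ran @^-1` U `&` src @^-1` U) y); last first.
  by rewrite memNset // !mul0r.
congr (_ * _); apply/eqP; rewrite -subr_eq0; apply/eqP.
by apply: contrapT => fgy; apply: (NK y fgy); split; exact: UN.
Qed.

(** The set is the image of [U] under the partial homeomorphism of the unit space that [C] induces
    from sources to ranges. *)
Lemma compact_open_transport C (U : set (unit_space G)) :
    compact_open_bisection C -> compact_open_set U ->
  compact_open_set (ran @` (C `&` src @^-1` U)).
Proof.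
move=> [[cC oC] _ _] [cU oU]; split.
  apply: continuous_compact.
    exact/continuous_subspaceT/ran_continuous.
  apply: compact_closedI => //.
  apply: preimage_closed => //; first by move=> x _; exact: src_continuous.
  by apply: compact_closed => //; exact: ample_hausdorff.
apply: ran_open => //; apply: openI => //.
by apply: open_comp => // x _; exact: src_continuous.
Qed.

(** If [c] is the arrow of [C] with range [src y], the two indicators move [y] to [y * c] and back.
    The condition that the source of [y * c] lies in [U] becomes a condition on [src y], namely
    membership in the transport of [U] along [C]. *)
Lemma corner_indic_inv f C (U : set (unit_space G)) :
    compact_open_bisection C ->
  convolution (\1_(ran @^-1` U `&` src @^-1` U) \* convolution f \1_C)
    \1_(ginv @` C) =
  \1_(ran @^-1` U `&` src @^-1` (ran @` (C `&` src @^-1` U))) \* f.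
Proof.
move=> bC; have [_ sC rC] := bC; have [_ sCV _] := bisection_inv bC.
apply/funext => y /=.
have [[c [Cc cy]]|nc] := pselect (exists c, C c /\ ran c = src y); last first.
  rewrite convolution_indicr0 => [|_ [c Cc <-]]; last first.
    by rewrite src_inv => cy; apply: nc; exists c.
  rewrite /indic memNset ?mul0r // => -[_ [c [Cc _] cy]].
  by apply: nc; exists c.
have CVc : (ginv @` C) (c^-1)%gpd by exists c.
rewrite (convolution_indicr _ sCV CVc) ?src_inv // ginvK /=.
have yc : composable y c by apply/composableP.
rewrite (convolution_indicr _ sC Cc) ?src_mul // gmulxK //; congr (_ * _).
rewrite /indic; congr ((nat_of_bool _)%:R); apply/idP/idP => /set_mem[Ur Us].
  apply/mem_set; split; first by move: Ur; rewrite /preimage /= ran_mul.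
  by exists c => //; split=> //; move: Us; rewrite /preimage /= src_mul.
apply/mem_set; split; rewrite /preimage /= ?ran_mul ?src_mul //.
have [c' [Cc' Uc'] c'y] := Us.
by rewrite (_ : c = c') //; apply: rC; rewrite ?inE // c'y.
Qed.

(** By [ideal_local] it is enough to find a corner of [f] around each arrow [x] that lies in [J].
    Multiplying by a bisection moves [x] to a unit, where the hypothesis on fibres gives such a
    corner of the product; the inverse bisection moves it back. *)
Lemma ideal_fiber_subset I J :
    two_sided_ideal (@convolution R G) (@steinberg R G) I ->
    two_sided_ideal (@convolution R G) (@steinberg R G) J ->
    (forall u, ideal_fiber I u `<=` ideal_fiber J u) ->
  I `<=` J.
Proof.
move=> idI idJ IJ f If; have sf := ideal_sub idI If.
apply: (ideal_local idJ sf) => x.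
(* Since [C] contains [x^-1], the value of [f] at [x] is the value of the product at the unit
   [ran x]. *)
have [C [bC Cx _]] := bisection_basis ampleG (@filterT _ (nbhs x^-1%gpd) _).
have sC := steinberg_bisection hausdorffG bC (R := R).
have [g Jg gE] : ideal_fiber J (ran x) (restr (convolution f \1_C) (ran x)).
  apply: IJ; exists (convolution f \1_C) => //.
  exact: Defs.idealMr idI _ _ If sC.
have [U [cU Ux UE]] := restr_eq_local (ideal_sub idJ Jg)
  (steinberg_convolution ampleG hausdorffG sf sC) gE.
have cV := compact_open_transport bC cU.
exists U, (ran @` (C `&` src @^-1` U)); split=> //.
  by exists (x^-1)%gpd; [split; rewrite // /preimage /= src_inv|rewrite ran_inv].
rewrite -corner_indic_inv // -UE; apply: (Defs.idealMr idJ).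
  exact: ideal_corner.
by apply: steinberg_bisection => //; exact: bisection_inv.
Qed.

End IdealLocalization.

(** * The correspondence *)

Section IdealBundle.
Context {R : comPzRingType} {G : topologicalGroupoidType}.
Context (ampleG : ample G) (hausdorffG : hausdorff_space G).
Implicit Types (f g h : G -> R) (B C : set G) (u v : unit_space G).
Implicit Types (I J : set (G -> R)) (Y : set (prebundle R G)).

Lemma fiber_ideal_bundle I u : fiber (ideal_bundle I) u = ideal_fiber I u.
Proof.
apply/seteqP; split=> [a [v _ [b Ib]] ab|a Ia]; last by exists u => //; exists a.
have vu : v = u by exact: existT_inj1 ab.
by subst v; rewrite -(existT_inj2 ab).
Qed.

(** An element of the group algebra is lifted by [steinberg_extension] to some [h] for which
    restriction to [u] respects the products with [f], so the closure properties of [I] descend to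
    the fibre. *)
Lemma ideal_fiber_ideal I u :
    two_sided_ideal (@convolution R G) (@steinberg R G) I ->
  two_sided_ideal (@group_convolution R (isotropy u))
    (@group_algebra R (isotropy u)) (ideal_fiber I u).
Proof.
move=> idI; have IA := ideal_sub idI; split.
- by move=> _ [f /IA sf <-]; exact: restr_group_algebra.
- by exists 0 => //; exact: ideal0 idI.
- move=> _ _ [f If <-] [g Ig <-]; exists (f - g) => //.
  exact: idealB idI _ _ If Ig.
- move=> a _ /(steinberg_extension ampleG hausdorffG)[h [sh <- hu]] [f If <-].
  exists (convolution h f); first exact: Defs.idealMl idI _ _ sh If.
  apply: restr_convolution => x y [sx rx] sy nuy.
  (* The arrow [x * y^-1] ends at [u]; if [h] were nonzero on it, it would also start at [u], and
     [y] would be isotropic. *)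
  suff -> : h (x * y^-1)%gpd = 0 by rewrite mul0r.
  apply: contrapT => /hu []; first by right; rewrite ran_divr ?sx.
  rewrite src_divr ?sx // => ry _; exact: nuy.
- move=> _ a [f If <-] /(steinberg_extension ampleG hausdorffG)[h [sh <- hu]].
  exists (convolution f h); first exact: Defs.idealMr idI _ _ If sh.
  apply: restr_convolution => x y _ sy nuy.
  suff -> : h y = 0 by rewrite mulr0.
  by apply: contrapT => /hu hy; apply: nuy; apply: hy; left.
Qed.

Lemma ideal_fiber_translation I u v (t : homset u v) :
    two_sided_ideal (@convolution R G) (@steinberg R G) I ->
  {homo translation t : a / ideal_fiber I u a >-> ideal_fiber I v a}.
Proof.
move=> idI _ [f If <-].
have [B [bB Bt _]] := bisection_basis ampleG (@filterT _ (nbhs (sval t)) _).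
have [_ sB rB] := bB; rewrite -(restr_conj_indic f sB rB Bt).
exists (convolution \1_B (convolution f \1_(ginv @` B))) => //.
apply: (Defs.idealMl idI); first exact: steinberg_bisection.
apply: (Defs.idealMr idI) => //.
by apply: steinberg_bisection => //; exact: bisection_inv.
Qed.

Lemma ideal_bundle_Delta I : steinberg_ideals R G I -> Delta R G (ideal_bundle I).
Proof.
move=> idI; have IA := ideal_sub idI; split.
- by move=> _ [u _ [_ [f /IA sf <-] <-]]; exact: restr_group_algebra.
- exists [set B | exists f U,
     [/\ I f, compact_open_set U & B = @bsection R G f @` U]].
    by move=> _ [f [U [/IA sf cU ->]]]; exists f, U.
  apply/seteqP; split.
    move=> _ [u _ [_ [f If <-] <-]].
    have [U [cU Uu _]] := unit_space_basis ampleG (@filterT _ (nbhs u) _).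
    by exists (bsection f @` U); [exists f, U|exists u].
  move=> _ [_ [f [U [If cU ->]]] [u Uu <-]].
  by exists u => //; exists (restr f u) => //; exists f.
- split.
  + by move=> u; rewrite fiber_ideal_bundle; exact: ideal_fiber_ideal.
  + move=> u v t; rewrite !fiber_ideal_bundle; apply: translation_algebra_iso.
      by move=> a; exact: ideal_fiber_translation.
    by move=> a; exact: ideal_fiber_translation.
  + move=> _ [u _ [_ [f If <-] <-]]; exists f; split=> //; first exact: IA.
    move=> v C bC; exists v => //.
    exists (restr (convolution f \1_C) v) => //.
    exists (convolution f \1_C) => //.
    by apply: (Defs.idealMr idI) => //; exact: steinberg_bisection.
Qed.

Lemma ideal_bundle_inj : set_inj (steinberg_ideals R G) (@ideal_bundle R G).
Proof.
move=> I J /set_mem idI /set_mem idJ IJ.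
have E u : ideal_fiber I u = ideal_fiber J u.
  by rewrite -!fiber_ideal_bundle IJ.
by apply/seteqP; split; apply: ideal_fiber_subset => // u; rewrite E.
Qed.

Definition bundle_ideal Y : set (G -> R) :=
  [set f | steinberg f /\ forall v C, compact_open_bisection C ->
     Y (bsection (convolution f \1_C) v)].

(** * Recovering a subset of the bundle from its ideal *)

Section Surjectivity.
Variables (Y : set (prebundle R G)) (condY : Delta_conditions Y).

Let idY u := Delta1 condY u.

Lemma fiberD u a b : fiber Y u a -> fiber Y u b -> fiber Y u (a + b).
Proof. exact: two_sided_idealD (idY u). Qed.

(** Closure under scalars is not among the fields of [two_sided_ideal]; it follows because [d],
    which is [c] times the identity of the group algebra, is an admissible left factor. *)
Lemma fiberZ u c (a : isotropy u -> R) : fiber Y u a -> fiber Y u (c \*o a).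
Proof.
move=> Ya; pose d : isotropy u -> R := fun x => if x == 1%g then c else 0.
have dA : group_algebra d.
  apply: (sub_finite_set _ (finite_set1 (1%g : isotropy u))) => x.
  by rewrite /d /=; case: eqP.
rewrite (_ : _ \*o _ = group_convolution d a).
  exact: Defs.idealMl (idY u) _ _ dA Ya.
apply/funext => x; rewrite /group_convolution -(fsbig_widen [set x]) //.
  by rewrite fsbig_set1 mulgV /d eqxx.
move=> y [_ /= yx]; rewrite /d; case: eqP => [|_]; last by rewrite mul0r.
by move/(congr1 (fun z => z * y)%g); rewrite mulgVK mul1g => xy; case: yx.
Qed.

(** The defining condition of [bundle_ideal] covers indicators of bisections, and it extends to all
    [h] because they span the algebra and the fibre is closed under sums and scalars. *)
Lemma bundle_ideal_convolution f h v : bundle_ideal Y f -> steinberg h ->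
  Y (bsection (convolution f h) v).
Proof.
move=> [sf Yf] sh.
suff [] : steinberg h /\ fiber Y v (restr (convolution f h) v) by [].
move: h sh; apply: (steinberg_ind ampleG hausdorffG).
- split; first exact: steinberg0.
  by rewrite convolution0r; exact: ideal0 (idY v).
- move=> g h [sg Yg] [sh Yh]; split; first exact: steinbergD.
  by rewrite convolutionDr //; exact: fiberD.
- move=> c B bB; have sB := steinberg_bisection hausdorffG bB (R := R).
  split; first exact: steinbergZ.
  by rewrite convolutionZr //; apply: fiberZ; exact: Yf.
Qed.

Lemma bundle_ideal_ideal : steinberg_ideals R G (bundle_ideal Y).
Proof.
have sI C : compact_open_bisection C -> steinberg (\1_C : G -> R).
  exact: steinberg_bisection.
split.
- by move=> f [].
- split=> [|v C bC]; first exact: steinberg0.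
  by rewrite convolution0l; exact: ideal0 (idY v).
- move=> f g [sf Yf] [sg Yg]; split=> [|v C bC]; first exact: steinbergB.
  have -> : convolution (f - g) \1_C = convolution f \1_C - convolution g \1_C.
    by apply/eqP; rewrite eq_sym subr_eq -convolutionDl ?subrK //; exact: sI.
  by apply: (idealB (idY v)); [exact: Yf|exact: Yg].
(* Left factors: after regrouping, the product is linear in [g], so [g] may be taken to be the
   indicator of a bisection [B]. *)
- move=> g f sg If; have [sf Yf] := If; split; first exact: steinberg_convolution.
  move=> v C bC; have [_ sC _] := bC; rewrite convolution_indicA //.
  have sh := steinberg_convolution ampleG hausdorffG sf (sI C bC).
  set h := convolution f \1_C in sh *; rewrite -[Y _]/(fiber Y v _).
  move: g sg; apply: (steinberg_ind ampleG hausdorffG).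
  + by rewrite convolution0l; exact: ideal0 (idY v).
  + by move=> g g' Yg Yg'; rewrite convolutionDl //; exact: fiberD.
  move=> c B bB; have [_ sB rB] := bB; rewrite convolutionZl //.
  suff : fiber Y v (restr (convolution \1_B h) v) by exact: fiberZ.
  have [[b [Bb bv]]|nb] := pselect (exists b, B b /\ ran b = v); last first.
    rewrite (_ : restr _ v = 0); first exact: ideal0 (idY v).
    apply/funext => z; apply: convolution_indicl0 => b Bb bz; apply: nb.
    by exists b; split=> //; rewrite bz; have [] := homsetP z.
  pose t : homset (src b) v := exist _ b (mem_set (conj erefl bv)).
  rewrite (restr_indicl h (t := t) sB rB Bb).
  have [[tY _ _] _ _ _] := Delta2 condY t; apply: tY.
  (* After the translation along [b], the indicator of [B] stands on the right and can be absorbed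
     into a right factor of [f]. *)
  rewrite /h convolution_indicA //; apply: bundle_ideal_convolution => //.
  by apply: steinberg_convolution => //; exact: sI.
- move=> f g If sg; have [sf Yf] := If; split; first exact: steinberg_convolution.
  move=> v C bC; have [_ sC _] := bC; rewrite convolution_indicA //.
  apply: bundle_ideal_convolution => //.
  by apply: steinberg_convolution => //; exact: sI.
Qed.

Lemma bundle_idealK : ideal_bundle (bundle_ideal Y) = Y.
Proof.
apply/seteqP; split.
- move=> _ [u _ [_ [f [sf Yf] <-] <-]].
  have [U [cU Uu _]] := unit_space_basis ampleG (@filterT _ (nbhs u) _).
  (* With a set of units around [u] as bisection, the product is a truncation of [f] that does not
     change its restriction to [u]. *)
  have := Yf u _ (sval_bisection ampleG cU); rewrite convolution_unit_indicr.
  rewrite /bsection (_ : restr (_ \* f) u = restr f u) //.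
  apply/funext => z; have [sz _] := homsetP z.
  by rewrite /restr /= /indic mem_set ?mul1r // /preimage /= sz.
- move=> [u a] Ya; have [f [sf fa Yf]] := Delta3 condY Ya.
  by exists u => //; exists (restr f u) => //; exists f.
Qed.

End Surjectivity.
End IdealBundle.

Theorem theorem3p2 (R : comPzRingType) (G : topologicalGroupoidType)
    (ampleG : ample G) (hausdorffG : hausdorff_space G) :
  set_bij (steinberg_ideals R G) (Delta R G) (@ideal_bundle R G).
Proof.
split; [exact: ideal_bundle_Delta|exact: ideal_bundle_inj|move=> Y [_ _ condY]].
exists (bundle_ideal Y); last exact: bundle_idealK.
exact: bundle_ideal_ideal.
Qed.
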